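(* For every nonnegative integer $k$ the inequality $v_5(a_n)\geq k$ has a unique solution $n$ modulo $5^k$ with $5\nmid n$; that is, there is exactly one residue class $C_k$ modulo $5^k$ such that a positive integer $n$ with $5\nmid n$ satisfies $5^k\mid a_n$ if and only if $n\in C_k$. Moreover, writing $n_k$ for the representative of $C_k$ with $0\leq n_k<5^k$, for every nonnegative integer $k$ one has $n_{k+1}\in\{n_k,\ 5^k+n_k,\ 2\cdot 5^k+n_k,\ 3\cdot 5^k+n_k,\ 4\cdot 5^k+n_k\}$, and $5^k\mid a_n$ for every positive integer $n\equiv n_k \pmod{5^k}$.
   Context: For a positive integer $n$, the Schenker sum is $a_n = \sum_{j=0}^{n}\frac{n!}{j!}n^j$. $v_5$ denotes the $5$-adic valuation. *)

(* Defs.v *)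
From mathcomp Require Import all_boot.

Set Implicit Arguments.
Unset Strict Implicit.
Unset Printing Implicit Defensive.

(* The division is exact, since j <= n. *)
Definition schenker (n : nat) : nat := \sum_(0 <= j < n.+1) n`! %/ j`! * n ^ j.

(* [logn 5 m] is v_5(m) for m > 0, and schenker n > 0 for every n > 0. *)
Definition schenker_sol (k n : nat) : Prop :=
  [/\ 0 < n, ~~ (5 %| n) & k <= logn 5 (schenker n)].

(* A residue class modulo 5 ^ k is given by its representative r < 5 ^ k. *)
Definition schenker_class (k r : nat) : Prop :=
  r < 5 ^ k /\
  forall n : nat, 0 < n -> ~~ (5 %| n) ->
    (5 ^ k %| schenker n <-> n = r %[mod 5 ^ k]).

(* Main.v *)
Require Import Defs.
From mathcomp Require Import all_boot.
From mathcomp Require Import ssralg ssrint intdiv.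
From mathcomp Require Import zify ring.

Import GRing.Theory.

(** Reversing the order of summation, [schenker n] is the sum of
    [n ^_ i * n ^ (n - i)] over [i <= n].  Both the base and the number of terms
    depend on [n], but [5 ^ k] divides [n ^_ i] as soon as [5 * k <= i]; hence,
    for [n] prime to [5], divisibility of [schenker n] by [5 ^ k] can be read off
    from the value at [n] of one polynomial with integer coefficients,
    [tsum m x], the sum of [x ^_ i * x ^ (m - i)] over [i <= m], for any fixed
    [m >= 5 * k] (lemma [dvd_schenker]).

    The roots of this polynomial can then be lifted by Hensel's method.  Modulo
    [5] the only root prime to [5] is [2] ([root_class1]), and it is simple
    ([tsum_simple_root]): this is computed at [m = 10] and persists for larger
    [m], because from degree [10] on the falling factorials contain two full
    sets of residues modulo [5], so that both their values and the values of
    their derivatives vanish modulo [5].  A simple root modulo [5 ^ k] has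
    exactly one lift modulo [5 ^ k.+1] ([root_class_lift]).  The truncation
    order [m] has to grow with [k], which is why the simplicity of the root is
    needed for all [m].

    The polynomials are given by recurrences for their values and for the
    values of their derivatives; this makes the residues needed computable, and
    a first-order Taylor expansion is all that is used about derivatives. *)

Set Implicit Arguments.
Unset Strict Implicit.
Unset Printing Implicit Defensive.

(** * Truncated Schenker sums as integer polynomials *)

(** The arguments are integers rather than natural numbers, because the Taylor
    expansion below is used with increments of either sign. *)
Fixpoint falling (i : nat) (x : int) : int :=
  if i is j.+1 then ((x - j%:Z) * falling j x)%R else 1%R.

(** Value at [x] of the derivative of the polynomial [falling i]. *)
Fixpoint dfalling (i : nat) (x : int) : int :=
  if i is j.+1 then (falling j x + (x - j%:Z) * dfalling j x)%R else 0%R.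

(** The sum of [falling i x * x ^+ (m - i)] over [i <= m], in Horner form
    ([tsum_sum]): [m] truncates the sum independently of [x]. *)
Fixpoint tsum (m : nat) (x : int) : int :=
  if m is l.+1 then (x * tsum l x + falling l.+1 x)%R else 1%R.

(** Value at [x] of the derivative of the polynomial [tsum m]. *)
Fixpoint dtsum (m : nat) (x : int) : int :=
  if m is l.+1 then (tsum l x + x * dtsum l x + dfalling l.+1 x)%R else 0%R.

Lemma tsumS (m : nat) (x : int) :
  tsum m.+1 x = (x * tsum m x + falling m.+1 x)%R.
Proof. by []. Qed.

Lemma dtsumS (m : nat) (x : int) :
  dtsum m.+1 x = (tsum m x + x * dtsum m x + dfalling m.+1 x)%R.
Proof. by []. Qed.

Lemma falling_nat (i n : nat) : falling i n = Posz (n ^_ i).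
Proof.
elim: i => [|i IHi] //=; rewrite IHi ffactnSr.
have [lt_ni | le_in] := ltnP n i; first by rewrite ffact_small // mulr0.
by rewrite PoszM mulrC -subzn.
Qed.

Lemma tsum_sum (m n : nat) :
  tsum m n = Posz (\sum_(0 <= i < m.+1) n ^_ i * n ^ (m - i)).
Proof.
elim: m => [|m IHm]; first by rewrite big_nat1.
rewrite [in RHS]big_nat_recr // subnn expn0 muln1 tsumS falling_nat IHm PoszD.
rewrite -PoszM big_distrr /=; congr (Posz _ + _)%R.
apply: eq_big_nat => i /andP[_ le_im].
by rewrite subSn // expnS; ring.
Qed.

Lemma schenker_tsum (n : nat) : Posz (schenker n) = tsum n n.
Proof.
rewrite tsum_sum /schenker; congr Posz.
rewrite big_nat_rev /= add0n; apply: eq_big_nat => i /andP[_ le_in].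
by rewrite subSS ffact_factd.
Qed.

(** * Reduction of Schenker sums to truncated sums *)

(** [n ^_ i] is a multiple of [i`!], which is a multiple of [(5 * k)`!], where
    the [k] factors [5, 10, ..., 5 * k] contribute a [5] each. *)
Lemma expn5_dvd_ffact (k i n : nat) : 5 * k <= i -> 5 ^ k %| n ^_ i.
Proof.
move=> le_ki; rewrite -bin_ffact dvdn_mull //.
have fact5 : 5 ^ k %| (5 * k)`!.
  elim: k {le_ki} => [|k IHk] //.
  have -> : 5 * k.+1 = (5 * k).+4.+1 by lia.
  rewrite factS expnS dvdn_mul //.
    by have -> : (5 * k).+4.+1 = 5 * k.+1; [lia | rewrite dvdn_mulr].
  by rewrite !factS !dvdn_mull.
by apply: (dvdn_trans fact5); rewrite -(bin_fact le_ki) mulnCA dvdn_mulr.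
Qed.

(** Adding one more term multiplies the sum by the unit [n], up to a term that
    vanishes modulo [5 ^ k]. *)
Lemma dvd_tsum_addn (k n m l : nat) : ~~ (5 %| n) ->
    (forall i, m < i -> 5 ^ k %| n ^_ i) ->
  (Posz (5 ^ k) %| tsum (l + m) n)%Z = (Posz (5 ^ k) %| tsum m n)%Z.
Proof.
move=> n5 tail; elim: l => [|l <-] //.
rewrite addSn tsumS falling_nat rpredDr ?Gauss_dvdzr //; last by apply: tail; lia.
by rewrite coprimezE !absz_nat coprimeXl // prime_coprime.
Qed.

(** The truncation orders [n] and [m] are compared through [n + m]: beyond [n]
    the terms are zero, and beyond [m] they are multiples of [5 ^ k]. *)
Lemma dvd_schenker (k m n : nat) : ~~ (5 %| n) -> 5 * k <= m ->
  (5 ^ k %| schenker n) = (Posz (5 ^ k) %| tsum m n)%Z.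
Proof.
move=> n5 le_km.
have -> : (5 ^ k %| schenker n) = (Posz (5 ^ k) %| Posz (schenker n))%Z by [].
rewrite schenker_tsum.
rewrite -(@dvd_tsum_addn k n n m n5); last first.
  by move=> i lt_ni; rewrite ffact_small.
rewrite addnC; apply: dvd_tsum_addn => // i lt_mi.
by apply: expn5_dvd_ffact; lia.
Qed.

(** * Taylor expansion and residues modulo 5 *)

Lemma falling_taylor (i : nat) (x h : int) :
  exists q, (falling i (x + h) = falling i x + h * dfalling i x + h ^+ 2 * q)%R.
Proof.
elim: i => [|i [q IHi]]; first by exists 0%R => /=; ring.
exists (dfalling i x + (x + h - i%:Z) * q)%R => /=; rewrite IHi; ring.
Qed.

Lemma tsum_taylor (m : nat) (x h : int) :
  exists q, (tsum m (x + h) = tsum m x + h * dtsum m x + h ^+ 2 * q)%R.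
Proof.
elim: m => [|m [q IHm]]; first by exists 0%R => /=; ring.
have [s Es] := falling_taylor m.+1 x h.
exists (dtsum m x + (x + h) * q + s)%R.
rewrite !tsumS dtsumS Es IHm; ring.
Qed.

Lemma falling_shift5 (i : nat) (x q : int) :
  exists u v, (falling i (x + 5 * q) = falling i x + 5 * u)%R /\
              (dfalling i (x + 5 * q) = dfalling i x + 5 * v)%R.
Proof.
elim: i => [|i [u [v [IHu IHv]]]]; first by exists 0%R, 0%R.
exists ((x - i%:Z) * u + q * (falling i x + 5 * u))%R.
exists (u + (x - i%:Z) * v + q * (dfalling i x + 5 * v))%R.
by rewrite /= IHu IHv; split; ring.
Qed.

Lemma tsum_shift5 (m : nat) (x q : int) :
  exists u v, (tsum m (x + 5 * q) = tsum m x + 5 * u)%R /\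
              (dtsum m (x + 5 * q) = dtsum m x + 5 * v)%R.
Proof.
elim: m => [|m [u [v [IHu IHv]]]]; first by exists 0%R, 0%R.
have [s [t [Es Et]]] := falling_shift5 m.+1 x q.
exists (x * u + q * (tsum m x + 5 * u) + s)%R.
exists (u + x * v + q * (dtsum m x + 5 * v) + t)%R.
by rewrite !tsumS !dtsumS Es Et IHu IHv; split; ring.
Qed.

(** A falling factorial of degree at least [10] contains two disjoint products
    of five consecutive factors; each of these takes only values divisible by
    [5], so that modulo [5] the derivative vanishes as well as the value. *)
Lemma falling_double5 (i : nat) (q : int) :
  (5 %| falling (i + 10) (2 + 5 * q))%Z /\ (5 %| dfalling (i + 10) (2 + 5 * q))%Z.
Proof.
elim: i => [|i [/dvdzP[a IHa] /dvdzP[b IHb]]].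
  have [u [v [-> ->]]] := falling_shift5 10 2 q.
  by split; (rewrite rpredDr; [vm_compute | apply: dvdz_mulr]).
rewrite addSn /= IHa IHb; split; apply/dvdzP.
  exists ((2 + 5 * q - (i + 10)%:Z) * a)%R; ring.
exists (a + (2 + 5 * q - (i + 10)%:Z) * b)%R; ring.
Qed.

(** The values at [m = 10] are [tsum 10 2 = 2560] and [dtsum 10 2 = 5344].  By
    [falling_double5], and since the value is [0], passing from [m] to [m.+1]
    just multiplies the derivative by the unit [2] modulo [5]. *)
Lemma tsum_simple_root (m : nat) (q : int) :
  (5 %| tsum (m + 10) (2 + 5 * q))%Z /\ ~~ (5 %| dtsum (m + 10) (2 + 5 * q))%Z.
Proof.
elim: m => [|m [IHt IHd]].
  have [u [v [-> ->]]] := tsum_shift5 10 2 q.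
  by split; (rewrite rpredDr; [vm_compute | apply: dvdz_mulr]).
have [Hf Hd] := falling_double5 m.+1 q.
rewrite addSn in Hf Hd *; rewrite tsumS dtsumS.
split; first by rewrite rpredD // dvdz_mull.
rewrite rpredDr // rpredDl // Gauss_dvdzr //.
by rewrite mulrC addrC /coprimez gcdzMDl.
Qed.

(** * Hensel lifting *)

Lemma eqn_mod_dvdz (d m n : nat) :
  (m == n %[mod d]) = (Posz d %| (Posz m - Posz n)%R)%Z.
Proof. by rewrite -eqz_mod_dvd !modz_nat. Qed.

Lemma linear_congruence (c d : int) : ~~ (5 %| d)%Z ->
  exists t : nat, forall s : int, (5 %| (c + s * d)%R)%Z = (5 %| (s - Posz t)%R)%Z.
Proof.
move=> d5; have cop : coprimez 5 d by rewrite coprimezE prime_coprime.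
have /coprimezP[[u v] /= Euv] := cop.
(* The Bezout coefficient [v] inverts [d] modulo 5; reducing the solution
   [- c * v] modulo 5 makes it a natural number. *)
pose w := ((- c * v)%R %/ 5)%Z.
have Et : Posz `|((- c * v)%R %% 5)%Z| = (- c * v - w * 5)%R.
  by rewrite gez0_abs ?modz_ge0 // {2}(divz_eq (- c * v) 5) addrC addKr.
exists `|((- c * v)%R %% 5)%Z| => s.
have -> : (c + s * d = (c * u - w * d) * 5
                     + d * (s - Posz `|((- c * v)%R %% 5)%Z|))%R.
  have Ec : c = (c * (u * 5 + v * d))%R by rewrite Euv mulr1.
  by rewrite Et {1}Ec; ring.
by rewrite rpredDl; [apply: Gauss_dvdzr | apply: dvdz_mull].
Qed.

(** Unlike [schenker_class], this does not ask for the reduced representative,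
    so that Hensel lifting can just add multiples of [5 ^ k]. *)
Definition root_class (k r : nat) : Prop :=
  forall n, ~~ (5 %| n) -> (5 ^ k %| schenker n) = (n == r %[mod 5 ^ k]).

Lemma root_class1 : root_class 1 2.
Proof.
move=> n n5; rewrite (dvd_schenker n5 (leqnn _)).
have [u [_ [Eu _]]] := tsum_shift5 (5 * 1) (Posz (n %% 5)) (Posz (n %/ 5)).
have -> : Posz n = (Posz (n %% 5) + 5 * Posz (n %/ 5))%R.
  by rewrite {1}(divn_eq n 5); lia.
rewrite Eu rpredDr; last exact: dvdz_mulr.
have := ltn_pmod n (isT : 0 < 5); rewrite /dvdn expn1 in n5 *.
by case: (n %% 5) n5 => [|[|[|[|[|]]]]] // _ _; vm_compute.
Qed.

(** Write a candidate as [n = r + s * 5 ^ k] and [tsum m r = c * 5 ^ k].  By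
    Taylor expansion [tsum m n] is [5 ^ k * (c + s * dtsum m r)] modulo
    [5 ^ k.+1], as [2 * k >= k.+1]; since [dtsum m r] is a unit modulo [5], this
    vanishes for exactly one residue of [s] modulo [5]. *)
Lemma root_class_lift (k r : nat) : 0 < k -> r %% 5 = 2 -> root_class k r ->
  exists r', r' %% 5 = 2 /\ root_class k.+1 r'.
Proof.
case: k => [//|k] _ r2 Hr; have r5 : ~~ (5 %| r) by rewrite /dvdn r2.
(* Large enough for precision [k.+2], and of the form to which
   [tsum_simple_root] applies. *)
pose m := 5 * k.+1 + 10.
have [lekm leSkm] : 5 * k.+1 <= m /\ 5 * k.+2 <= m by rewrite /m; lia.
have /dvdzP[c Ec] : (Posz (5 ^ k.+1) %| tsum m r)%Z by rewrite -dvd_schenker ?Hr.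
have d5 : ~~ (5 %| dtsum m r)%Z.
  have -> : Posz r = (2 + 5 * Posz (r %/ 5))%R.
    by rewrite {1}(divn_eq r 5) r2; lia.
  by case: (tsum_simple_root (5 * k.+1) (Posz (r %/ 5))).
have [t Ht] := linear_congruence c d5.
exists (r + 5 ^ k.+1 * t); split.
  by rewrite addnC expnS -mulnA mulnC modnMDl.
move=> n n5; rewrite (dvd_schenker n5 leSkm) eqn_mod_dvdz.
have nz5 : Posz (5 ^ k.+1) != 0%R by rewrite -lt0n expn_gt0.
have E5 : Posz (5 ^ k.+2) = (Posz (5 ^ k.+1) * 5)%R by rewrite expnSr PoszM.
case: (boolP (n == r %[mod 5 ^ k.+1])) => [|nr].
  rewrite eqn_mod_dvdz => /dvdzP[s Es].
  have En : Posz n = (Posz r + s * Posz (5 ^ k.+1))%R by lia.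
  have [q Eq] := tsum_taylor m (Posz r) (s * Posz (5 ^ k.+1))%R.
  rewrite En Eq Ec E5 PoszD PoszM.
  have -> : (c * Posz (5 ^ k.+1) + s * Posz (5 ^ k.+1) * dtsum m r
      + (s * Posz (5 ^ k.+1)) ^+ 2 * q
    = Posz (5 ^ k.+1) * (c + s * dtsum m r + 5 * (Posz (5 ^ k) * s ^+ 2 * q)))%R.
    by rewrite expnS PoszM; ring.
  have -> : (Posz r + s * Posz (5 ^ k.+1) - (Posz r + Posz (5 ^ k.+1) * Posz t)
    = Posz (5 ^ k.+1) * (s - Posz t))%R by ring.
  by rewrite !dvdz_mul2l // rpredDr; [apply: Ht | apply: dvdz_mulr].
have dvdE : (Posz (5 ^ k.+1) %| Posz (5 ^ k.+2))%Z by rewrite E5 dvdz_mulr.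
(* Outside the class of [r] modulo [5 ^ k.+1] both sides are false. *)
transitivity false; [|symmetry]; apply: contraNF nr => /(dvdz_trans dvdE).
  by rewrite -dvd_schenker // Hr.
by rewrite -eqn_mod_dvdz addnC mulnC modnMDl.
Qed.

Lemma root_class_exists (k : nat) : exists r, r %% 5 = 2 /\ root_class k r.
Proof.
case: k => [|k]; first by exists 2; split=> // n _; rewrite expn0 dvd1n !modn1.
elim: k => [|k [r [r2 Hr]]]; first by exists 2; split=> //; exact: root_class1.
exact: root_class_lift Hr.
Qed.

(** * Solutions and residue classes *)

Lemma schenker_classE (k r0 r : nat) : r0 %% 5 = 2 -> root_class k r0 ->
  schenker_class k r <-> r = r0 %% 5 ^ k.
Proof.
move=> r2 Hr0; have r05 : ~~ (5 %| r0) by rewrite /dvdn r2.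
split=> [[lt_r Hr] | ->].
  have r0_gt0 : 0 < r0 by case: r0 r2 {Hr0 r05}.
  have /Hr -> // : 5 ^ k %| schenker r0 by rewrite Hr0.
  by rewrite modn_small.
split=> [|n _ n5]; first by rewrite ltn_mod expn_gt0.
by rewrite Hr0 // modn_mod; split=> /eqP.
Qed.

Lemma schenker_gt0 (n : nat) : 0 < n -> 0 < schenker n.
Proof.
move=> n_gt0; rewrite /schenker big_nat_recr //= divnn fact_gt0 mul1n.
by rewrite addn_gt0 expn_gt0 n_gt0 orbT.
Qed.

Lemma schenker_solE (k r n : nat) : r %% 5 = 2 -> root_class k r ->
  schenker_sol k n <-> ~~ (5 %| n) /\ n = r %[mod 5 ^ k].
Proof.
move=> r2 Hr; split=> [[n_gt0 n5]|[n5 Enr]].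
  by rewrite -pfactor_dvdn ?schenker_gt0 // Hr // => /eqP.
have n_gt0 : 0 < n by case: n n5 {Enr}.
by split=> //; rewrite -pfactor_dvdn ?schenker_gt0 // Hr // Enr.
Qed.

(** For [k > 0] the class of [r] consists of numbers congruent to [2] modulo
    [5], so the condition [~~ (5 %| n)] comes for free on it. *)
Lemma root_class_dvd (k r n : nat) : r %% 5 = 2 -> root_class k r ->
  n = r %[mod 5 ^ k] -> 5 ^ k %| schenker n.
Proof.
case: k => [|k] r2 Hr Enr; first by rewrite dvd1n.
rewrite Hr ?Enr // /dvdn.
have dvd5 : 5 %| 5 ^ k.+1 by rewrite dvdn_exp.
by rewrite -(modn_dvdm n dvd5) Enr modn_dvdm // r2.
Qed.

(** A solution modulo [5 ^ k.+1] is a solution modulo [5 ^ k], hence lies in the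
    unique class there. *)
Lemma root_class_restrict (k r r' : nat) : r' %% 5 = 2 ->
  root_class k r -> root_class k.+1 r' -> r' = r %[mod 5 ^ k].
Proof.
move=> r2 Hr Hr'; have r5 : ~~ (5 %| r') by rewrite /dvdn r2.
apply/eqP; rewrite -Hr //; apply: (@dvdn_trans (5 ^ k.+1)).
  exact: dvdn_exp2l.
by rewrite Hr'.
Qed.

Theorem mainTheorem2 :
  (forall k : nat,
     [/\ exists n : nat, schenker_sol k n,
         forall m n : nat, schenker_sol k m -> schenker_sol k n ->
           m = n %[mod 5 ^ k]
       & exists! r : nat, schenker_class k r])
  /\
  (forall nn : nat -> nat, (forall k : nat, schenker_class k (nn k)) ->
     forall k : nat,
       nn k.+1 \in [:: nn k; 5 ^ k + nn k; 2 * 5 ^ k + nn k;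
                       3 * 5 ^ k + nn k; 4 * 5 ^ k + nn k]
       /\ forall n : nat, 0 < n -> n = nn k %[mod 5 ^ k] ->
            5 ^ k %| schenker n).
Proof.
split=> [k | nn Hnn k].
  have [r [r2 Hr]] := root_class_exists k; split.
  - by exists r; apply/(schenker_solE r r2 Hr); rewrite /dvdn r2.
  - move=> m n /(schenker_solE m r2 Hr)[_ ->].
    by move=> /(schenker_solE n r2 Hr)[_ ->].
  - exists (r %% 5 ^ k); split; first by apply/(schenker_classE _ r2 Hr).
    by move=> s /(schenker_classE s r2 Hr) ->.
have [r [r2 Hr]] := root_class_exists k.
have [r' [r'2 Hr']] := root_class_exists k.+1.
have /(schenker_classE _ r2 Hr) Ek := Hnn k.
have /(schenker_classE _ r'2 Hr') Ek' := Hnn k.+1.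
split=> [|n _]; last by rewrite Ek modn_mod; apply: root_class_dvd.
have Emod : nn k.+1 %% 5 ^ k = nn k.
  rewrite Ek' Ek modn_dvdm ?dvdn_exp2l //; exact: root_class_restrict Hr'.
have lt5 : nn k.+1 %/ 5 ^ k < 5.
  by rewrite ltn_divLR ?expn_gt0 // -expnS Ek' ltn_mod expn_gt0.
rewrite (divn_eq (nn k.+1) (5 ^ k)) Emod.
case: (nn k.+1 %/ 5 ^ k) lt5 => [|[|[|[|[|]]]]] // _.
all: by rewrite !inE ?mul0n ?mul1n eqxx ?orbT.
Qed.
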